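(* Let $\hat x_0,\dots,\hat x_{T-1}$ be the decisions produced by AdaScale and let $x_0^\star,\dots,x_{T-1}^\star$ be an offline optimal solution of the constrained problem (P), both defined in the context. Put $\hat\sigma_{m,t}=\sigma_{m,t}(\hat x_t)$ and $\sigma_{m,t}^\star=\sigma_{m,t}(x_t^\star)$. Then $$\frac1T\sum_{t=0}^{T-1}\sum_{m=1}^M\Big(\rho_\alpha(q_m,\hat\sigma_{m,t})-\rho_\alpha(q_m,\sigma_{m,t}^\star)\Big)\le\frac{Q_T^{\max}\nu}{V}+\frac{T\nu^2}{2V}+\frac{\nu^2}{2V},$$ where $$Q_T^{\max}=\Big(2V\sum_{t=0}^{T-1}\sum_{m=1}^M\rho_\alpha(q_m,\sigma_{m,t}^{\min})+T\nu^2\Big)^{1/2},\qquad \sigma_{m,t}^{\min}=\frac{\sigma_nMB_m}{G\,h_{\min,t}\sqrt{2x_{\max}}}.$$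
   Context: Parameters: integers $M,T,d\ge1$ and $\alpha>1$; reals $\sigma_n,G,P_{\max},V>0$ and $\nu\ge0$; integers $1\le B_m\le n_m$ and $q_m=B_m/n_m$, $k_m=\sqrt{1+(1-q_m)/B_m}$ for $m=1,\dots,M$; nonzero channel coefficients $h_{m,t}\in\mathbb{C}$ for $1\le m\le M$, $0\le t\le T-1$. Put $h_{\min,t}=\min_m\frac{|h_{m,t}|}{k_m}$ and $x_{\max}=\frac{P_{\max}dM^2}{G^2}$. For $q\in(0,1]$, $\sigma>0$: $\rho_\alpha(q,\sigma)=\frac{1}{\alpha-1}\ln\big[\sum_{k=0}^{\alpha}\binom{\alpha}{k}(1-q)^{\alpha-k}q^k\exp\big(\frac{k^2-k}{2\sigma^2}\big)\big]$ (with $0^0=1$). For $x>0$: $\sigma_{m,t}(x)=\frac{MB_m\sigma_n}{\sqrt{2x}\,G\,h_{\min,t}}$. Problem (P): minimize $\frac1T\sum_{t=0}^{T-1}\sum_{m=1}^M\rho_\alpha(q_m,\sigma_{m,t}(x_t))$ over $(x_0,\dots,x_{T-1})$ subject to $\frac1T\sum_{t=0}^{T-1}\frac{d\sigma_n^2}{h_{\min,t}^2}\big(\frac1{x_t}-\frac1{x_{\max}}\big)\le\nu$ and $0<x_t\le x_{\max}$ for all $t$. The offline optimal solution is a minimizer of (P) with all $h_{m,t}$ known. AdaScale: start with $Q_0=0$. For $t=0,\dots,T-1$, let $\hat x_t$ be a minimizer over $x\in(0,x_{\max}]$ of $$V\sum_{m=1}^M\rho_\alpha(q_m,\sigma_{m,t}(x))+Q_t\frac{d\sigma_n^2}{h_{\min,t}^2}\Big(\frac1x-\frac1{x_{\max}}\Big)+\frac12\Big(\frac{d\sigma_n^2}{h_{\min,t}^2}\Big)^2\Big(\frac1x-\frac1{x_{\max}}\Big)^2,$$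 and update the virtual queue $Q_{t+1}=\max\big\{Q_t+\frac{d\sigma_n^2}{h_{\min,t}^2}\big(\frac1{\hat x_t}-\frac1{x_{\max}}\big)-\nu,\,0\big\}$. *)

(* Defs.v *)
From HB Require Import structures.
From mathcomp Require Import all_boot all_order all_algebra.
From mathcomp Require Import complex.
From mathcomp Require Import all_classical all_reals all_analysis.

Set Implicit Arguments.
Unset Strict Implicit.
Unset Printing Implicit Defensive.

Import Order.TTheory GRing.Theory Num.Theory.

Local Open Scope classical_set_scope.
Local Open Scope ring_scope.

(* Clients are indexed by m : 'I_M and rounds 0, ..., T - 1 by t : 'I_T;
   the Renyi order alpha is an integer, hence a nat. *)
Record fl_system (R : realType) := FLSystem {
  clients : nat;
  rounds : nat;
  dim : nat;
  alpha : nat;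
  sigma_n : R;
  clip : R;                              (* G *)
  Pmax : R;
  nu : R;
  batch : 'I_clients -> nat;             (* B_m *)
  dataset : 'I_clients -> nat;           (* n_m *)
  channel : 'I_clients -> 'I_rounds -> R[i];
  clients_gt0 : (0 < clients)%N;
  rounds_gt0 : (0 < rounds)%N;
  dim_gt0 : (0 < dim)%N;
  alpha_gt1 : (1 < alpha)%N;
  sigma_n_gt0 : 0 < sigma_n;
  clip_gt0 : 0 < clip;
  Pmax_gt0 : 0 < Pmax;
  nu_ge0 : 0 <= nu;
  batch_gt0 : forall m, (0 < batch m)%N;
  batch_le : forall m, (batch m <= dataset m)%N;
  channel_neq0 : forall m t, channel m t != 0
}.

Definition is_minimizer (R : realType) (X : Type) (A : set X) (f : X -> R)
    (x : X) : Prop :=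
  A x /\ forall y, A y -> f x <= f y.

Definition rho (R : realType) (alpha : nat) (q sigma : R) : R :=
  (alpha%:R - 1)^-1 *
  ln (\sum_(k < alpha.+1) 'C(alpha, k)%:R * (1 - q) ^+ (alpha - k) * q ^+ k
        * expR ((k%:R ^+ 2 - k%:R) / (2 * sigma ^+ 2))).

Section System.
Context (R : realType) (s : fl_system R).
Local Notation M := (clients s).
Local Notation T := (rounds s).
Local Notation G := (clip s).

Definition qrate (m : 'I_M) : R := (batch m)%:R / (dataset m)%:R.

Definition kfac (m : 'I_M) : R :=
  Num.sqrt (1 + (1 - qrate m) / (batch m)%:R).

(* normc is the R-valued modulus; the norm of R[i] is R[i]-valued. *)
Definition gain (m : 'I_M) (t : 'I_T) : R :=
  Normc.normc (channel m t) / kfac m.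

(* The base value of the iterated min is the entry m = 0, so this is the true
   minimum over the (nonempty) set of clients. *)
Definition hmin (t : 'I_T) : R :=
  \big[Num.min/gain (Ordinal (clients_gt0 s)) t]_(m < M) gain m t.

Definition xmax : R := Pmax s * (dim s)%:R * M%:R ^+ 2 / G ^+ 2.

Definition sigma (m : 'I_M) (t : 'I_T) (x : R) : R :=
  M%:R * (batch m)%:R * sigma_n s / (Num.sqrt (2 * x) * G * hmin t).

Definition sigma_min (m : 'I_M) (t : 'I_T) : R :=
  sigma_n s * M%:R * (batch m)%:R / (G * hmin t * Num.sqrt (2 * xmax)).

Definition privacy_loss (t : 'I_T) (x : R) : R :=
  \sum_(m < M) rho (alpha s) (qrate m) (sigma m t x).

Definition noise_cost (t : 'I_T) (x : R) : R :=
  (dim s)%:R * sigma_n s ^+ 2 / hmin t ^+ 2 * (x^-1 - xmax^-1).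

Definition feasible : set ('I_T -> R) :=
  [set x | T%:R^-1 * \sum_(t < T) noise_cost t (x t) <= nu s /\
           forall t, 0 < x t <= xmax].

Definition offline_optimal (x : 'I_T -> R) : Prop :=
  is_minimizer feasible
    (fun y => T%:R^-1 * \sum_(t < T) privacy_loss t (y t)) x.

Definition slot_objective (V Qt : R) (t : 'I_T) (x : R) : R :=
  V * privacy_loss t x + Qt * noise_cost t x
  + 2^-1 * ((dim s)%:R * sigma_n s ^+ 2 / hmin t ^+ 2) ^+ 2
    * (x^-1 - xmax^-1) ^+ 2.

(* Q is the virtual queue along the run; only Q 0, ..., Q T are constrained.
   Any selection among the minimizers of a round is allowed. *)
Definition adascale (V : R) (x : 'I_T -> R) : Prop :=
  exists Q : nat -> R,
    Q 0%N = 0 /\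
    forall t : 'I_T,
      is_minimizer [set y | 0 < y <= xmax] (slot_objective V (Q t) t) (x t) /\
      Q t.+1 = Num.max (Q t + noise_cost t (x t) - nu s) 0.

Definition Qmax (V : R) : R :=
  Num.sqrt (2 * V * (\sum_(t < T) \sum_(m < M)
                       rho (alpha s) (qrate m) (sigma_min m t))
            + T%:R * nu s ^+ 2).

End System.

(* Main.v *)
(** Drift-plus-penalty. Write [y_t] for the noise cost of round [t]. Squaring the
    queue update gives
    [Q_(t+1)^2 - Q_t^2 <= 2 (Q_t y_t + y_t^2 / 2) - 2 nu (Q_t + y_t) + nu^2],
    whose first term is the part of the slot objective that AdaScale controls.
    Comparing the minimizer with [x = xmax], where the noise cost vanishes, and
    telescoping gives [Q_t <= Qmax]. Comparing it with the offline optimum and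
    telescoping leaves [sum_t Q_t y*_t + (sum_t y*_t^2) / 2], which is bounded by
    means of [Q_t <= Qmax], [y*_t >= 0] and [sum_t y*_t <= T nu]. *)

Require Import Defs.
From HB Require Import structures.
From mathcomp Require Import all_boot all_order all_algebra.
From mathcomp Require Import complex.
From mathcomp Require Import all_classical all_reals all_analysis.
From mathcomp Require Import ring lra.
Import Order.TTheory GRing.Theory Num.Theory.
Local Open Scope ring_scope.

(** Increments are controlled only at ordinals below [T], hence the filtered sum. Taking [n] to be a
    round serves the queue bound, and [n = T] the regret. *)
Lemma ler_telescope_ord (R : numDomainType) (T : nat) (u : nat -> R)
    (a : 'I_T -> R) :
  (forall t : 'I_T, u t.+1 - u t <= a t) ->
  forall n : nat, (n <= T)%N -> u n - u 0%N <= \sum_(t < T | (t < n)%N) a t.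
Proof.
move=> ha; elim=> [_|n IHn ltnT]; first by rewrite subrr big_pred0.
rewrite (bigD1 (Ordinal ltnT)) //=.
rewrite (eq_bigl (fun t : 'I_T => (t < n)%N)); last first.
  by move=> t; rewrite ltnS -val_eqE /= [RHS]ltn_neqAle andbC.
rewrite -(subrKA (u n)); apply: lerD; first exact: ha (Ordinal ltnT).
exact: IHn (ltnW ltnT).
Qed.

(** Each [y i] is at most the whole sum, the other terms being nonnegative. *)
Lemma sum_sqr_le (R : numDomainType) (I : finType) (y : I -> R) :
  (forall i, 0 <= y i) -> \sum_i y i ^+ 2 <= (\sum_i y i) ^+ 2.
Proof.
move=> y0; rewrite expr2 mulr_suml; apply: ler_sum => i _.
rewrite expr2; apply: ler_wpM2l => //.
by rewrite (bigD1 i) //= lerDl sumr_ge0.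
Qed.

Lemma sqr_max0_le (R : realDomainType) (a : R) : Num.max a 0 ^+ 2 <= a ^+ 2.
Proof. by rewrite maxEle; case: ifP => // _; rewrite expr0n /= sqr_ge0. Qed.

(** Since [k <= k ^ 2] for natural [k], every exponential is at least 1, and so is the argument of
    [ln]. *)
Lemma rho_ge0 (R : realType) (alpha : nat) (q sigma : R) :
  (0 < alpha)%N -> 0 <= q <= 1 -> 0 <= rho alpha q sigma.
Proof.
move=> alpha0 /andP[q0 q1]; apply: mulr_ge0.
  by rewrite invr_ge0 subr_ge0 ler1n.
apply: ln_ge0.
(* By the binomial theorem, the sum without the exponentials is exactly 1. *)
rewrite [leLHS](_ : 1 = \sum_(k < alpha.+1)
    'C(alpha, k)%:R * (1 - q) ^+ (alpha - k) * q ^+ k); last first.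
  rewrite -[LHS](expr1n _ alpha) -[X in X ^+ _ = _](subrK q) exprDn.
  by apply: eq_bigr => k _; rewrite -mulrA mulr_natl.
apply: ler_sum => k _; apply: ler_peMr.
  by rewrite !mulr_ge0 ?exprn_ge0 ?subr_ge0.
rewrite -[leLHS]expR0 ler_expR; apply: divr_ge0; last first.
  by rewrite mulr_ge0 ?sqr_ge0.
rewrite subr_ge0 -natrX ler_nat.
by case: (k : nat) => // n; rewrite -mulnn leq_pmulr.
Qed.

Section System.
Context (R : realType) (s : fl_system R).
Local Notation T := (rounds s).
Implicit Types (V x : R) (t : 'I_T).

Lemma qrate_itv (m : 'I_(clients s)) : 0 <= qrate m <= 1.
Proof.
have n0 : (0 < dataset m)%N := leq_trans (batch_gt0 m) (batch_le m).
by rewrite divr_ge0 //= ler_pdivrMr ?ltr0n // mul1r ler_nat batch_le.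
Qed.

Lemma privacy_loss_ge0 t x : 0 <= privacy_loss t x.
Proof.
apply: sumr_ge0 => m _; apply: rho_ge0; last exact: qrate_itv.
exact: ltnW (alpha_gt1 s).
Qed.

Lemma xmax_gt0 : 0 < xmax s.
Proof.
by rewrite /xmax !(mulr_gt0, invr_gt0, exprn_gt0) ?Pmax_gt0 ?clip_gt0 ?ltr0n
  ?dim_gt0 ?clients_gt0.
Qed.

(** Links the comparison point [xmax] to the sum under the root of [Qmax]. *)
Lemma privacy_loss_xmax t :
  privacy_loss t (xmax s) =
  \sum_(m < clients s) rho (alpha s) (qrate m) (sigma_min m t).
Proof.
apply: eq_bigr => m _; congr rho.
by rewrite /sigma /sigma_min; congr (_ / _); ring.
Qed.

Lemma noise_cost_ge0 t x : 0 < x <= xmax s -> 0 <= noise_cost t x.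
Proof.
move=> /andP[x0 xle]; apply: mulr_ge0.
  by apply: divr_ge0; rewrite ?sqr_ge0 // mulr_ge0 ?ler0n // sqr_ge0.
by rewrite subr_ge0 lef_pV2 ?posrE ?xmax_gt0.
Qed.

Lemma noise_cost_xmax t : noise_cost t (xmax s) = 0.
Proof. by rewrite /noise_cost subrr mulr0. Qed.

Lemma slot_objectiveE V Qt t x :
  slot_objective V Qt t x =
  V * privacy_loss t x + Qt * noise_cost t x + 2^-1 * noise_cost t x ^+ 2.
Proof. by rewrite /slot_objective -mulrA -exprMn. Qed.

(** The competitor [y] is left free: [xmax] will bound the queue, the offline decision the
    regret. *)
Lemma drift_plus_penalty V Qt t x y :
  is_minimizer [set z | 0 < z <= xmax s]%classic (slot_objective V Qt t) x ->
  0 < y <= xmax s -> 0 <= Qt ->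
  Num.max (Qt + noise_cost t x - nu s) 0 ^+ 2 - Qt ^+ 2 <=
  2 * V * (privacy_loss t y - privacy_loss t x) + 2 * Qt * noise_cost t y
    + noise_cost t y ^+ 2 + nu s ^+ 2.
Proof.
move=> [/= xA xmin] yA Q0; have := xmin y yA; rewrite !slot_objectiveE => le_xy.
have := sqr_max0_le _ (Qt + noise_cost t x - nu s).
have : 0 <= nu s * (Qt + noise_cost t x).
  by rewrite mulr_ge0 ?nu_ge0 ?addr_ge0 ?noise_cost_ge0.
move: (nu s) (noise_cost t x) (noise_cost t y) le_xy => n a b.
set m := Num.max _ _; nra.
Qed.

Lemma queue_le_Qmax V (xhat : 'I_T -> R) (Q : nat -> R) :
  0 <= V -> Q 0%N = 0 -> (forall t, 0 <= Q t) ->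
  (forall t, is_minimizer [set z | 0 < z <= xmax s]%classic
       (slot_objective V (Q t) t) (xhat t) /\
     Q t.+1 = Num.max (Q t + noise_cost t (xhat t) - nu s) 0) ->
  forall t, Q t <= Qmax s V.
Proof.
move=> V0 Q00 Q0 hQ t.
pose a (u : 'I_T) := 2 * V * privacy_loss u (xmax s) + nu s ^+ 2.
have a0 u : 0 <= a u.
  by rewrite addr_ge0 ?sqr_ge0 ?mulr_ge0 ?privacy_loss_ge0.
have step (u : 'I_T) : Q u.+1 ^+ 2 - Q u ^+ 2 <= a u.
  have [xmin ->] := hQ u.
  have xmaxA : 0 < xmax s <= xmax s by rewrite xmax_gt0 lexx.
  apply: le_trans (drift_plus_penalty _ _ _ _ _ xmin xmaxA (Q0 u)) _.
  rewrite noise_cost_xmax mulr0 expr0n /= !addr0 lerD2r.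
  by rewrite ler_wpM2l ?mulr_ge0 // lerBlDr lerDl privacy_loss_ge0.
have := ler_telescope_ord _ _ (fun n => Q n ^+ 2) a step t (ltnW (ltn_ord t)).
rewrite Q00 expr0n subr0 => Qt2.
rewrite -(ger0_norm (Q0 t)) -sqrtr_sqr; apply: ler_wsqrtr.
(* The sum over rounds before [t] is extended to all rounds, as [a] is nonnegative; the total is the
   radicand of [Qmax]. *)
apply: le_trans Qt2 _; apply: (@le_trans _ _ (\sum_u a u)).
  by rewrite [leRHS](bigID (fun u : 'I_T => (u < t)%N)) /= lerDl sumr_ge0.
rewrite big_split /= sumr_const card_ord -[_ *+ T]mulr_natl -mulr_sumr lerD2r.
by rewrite (eq_bigr _ (fun u _ => privacy_loss_xmax u)).
Qed.

Lemma regret_bound V (xhat xstar : 'I_T -> R) :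
  0 < V -> adascale V xhat -> feasible xstar ->
  \sum_(t < T) (privacy_loss t (xhat t) - privacy_loss t (xstar t)) <=
  T%:R * (Qmax s V * nu s / V + T%:R * nu s ^+ 2 / (2 * V)
          + nu s ^+ 2 / (2 * V)).
Proof.
move=> V0 [Q [Q00 hQ]] [/= cost_le starA].
have Q0 (t : 'I_T) : 0 <= Q t.
  (* At a positive round the sign comes from the update of the preceding round, a maximum with 0. *)
  case: t => -[|n] ltnT /=; first by rewrite Q00.
  by have [_ /= ->] := hQ (Ordinal (ltnW ltnT)); rewrite le_max lexx orbT.
have QM t : Q t <= Qmax s V := queue_le_Qmax _ _ _ (ltW V0) Q00 Q0 hQ t.
pose y t := noise_cost t (xstar t).
have y0 t : 0 <= y t := noise_cost_ge0 _ _ (starA t).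
have sum_y : \sum_t y t <= T%:R * nu s.
  by rewrite -ler_pdivrMl ?ltr0n ?rounds_gt0.
have sum_y2 : \sum_t y t ^+ 2 <= (T%:R * nu s) ^+ 2.
  apply: le_trans (sum_sqr_le _ _ _ y0) _.
  by rewrite ler_sqr ?nnegrE ?mulr_ge0 ?nu_ge0 ?sumr_ge0.
have sum_Qy : \sum_(t < T) Q t * y t <= Qmax s V * (T%:R * nu s).
  apply: (@le_trans _ _ (Qmax s V * \sum_t y t)).
    by rewrite mulr_sumr; apply: ler_sum => t _; apply: ler_wpM2r.
  by apply: ler_wpM2l; rewrite ?sqrtr_ge0.
pose a (t : 'I_T) := 2 * V * (privacy_loss t (xstar t) - privacy_loss t (xhat t))
    + 2 * Q t * y t + y t ^+ 2 + nu s ^+ 2.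
have step (t : 'I_T) : Q t.+1 ^+ 2 - Q t ^+ 2 <= a t.
  by have [xmin ->] := hQ t; exact: drift_plus_penalty.
have := ler_telescope_ord _ _ (fun n => Q n ^+ 2) a step T (leqnn _).
rewrite Q00 expr0n subr0; under [X in _ <= X -> _]eq_bigl do rewrite ltn_ord.
(* The final squared queue is nonnegative and is discarded. *)
move/(le_trans (sqr_ge0 _)).
rewrite !big_split /= sumr_const card_ord -[_ *+ T]mulr_natl -mulr_sumr.
under [X in _ + X + _ + _]eq_bigr => t _ do rewrite -mulrA.
rewrite -mulr_sumr sumrB sumrN => sum_a.
rewrite -(ler_pM2l (mulr_gt0 (ltr0n R 2) V0)).
(* Scaled by [2 * V], the three terms are twice the bound in [sum_Qy], the bound in [sum_y2], and
   the [T] drift constants [nu s ^+ 2]. *)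
have -> : 2 * V * (T%:R * (Qmax s V * nu s / V + T%:R * nu s ^+ 2 / (2 * V)
          + nu s ^+ 2 / (2 * V)))
    = 2 * (Qmax s V * (T%:R * nu s)) + (T%:R * nu s) ^+ 2
      + T%:R * nu s ^+ 2.
  by field; rewrite gt_eqF.
lra.
Qed.

End System.

Theorem theorem3 (R : realType) (s : fl_system R) (V : R) (hV : 0 < V)
    (xhat xstar : 'I_(rounds s) -> R)
    (hhat : adascale V xhat) (hstar : offline_optimal xstar) :
  (rounds s)%:R^-1 * (\sum_(t < rounds s) \sum_(m < clients s)
     (rho (alpha s) (qrate m) (sigma m t (xhat t))
      - rho (alpha s) (qrate m) (sigma m t (xstar t))))
  <= Qmax s V * nu s / V + (rounds s)%:R * nu s ^+ 2 / (2 * V)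
     + nu s ^+ 2 / (2 * V).
Proof.
rewrite ler_pdivrMl ?ltr0n ?rounds_gt0 //.
under eq_bigr => t _ do rewrite sumrB.
exact: regret_bound hV hhat hstar.1.
Qed.
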